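(* Let $n\ge1$, let $\tau$ be one of the three transpositions in the group $S_3$ of permutations of $\{1,2,4\}$, acting linearly on $\mathcal A_n$, and suppose that $X,Y\in\mathcal A_n$ satisfy $$\tau(X)=X,\qquad \tau(Y)=Y.$$ Then $\tau(XY)=YX$. Consequently $XY$ is symmetric with respect to the same axis, that is $\tau(XY)=XY$, if and only if $XY=YX$.
   Context: $\Delta_n=\{1,2,4,7\}^n$ is the set of words of length $n$. Digits are identified with quaternionic symbols: $1=i$, $2=j$, $4=k$, $7=e$, where $e$ is the identity, $i^2=j^2=k^2=-e$, $ij=k=-ji$, $jk=i=-kj$, $ki=j=-ik$. Words are multiplied coordinate by coordinate, with the local quaternionic signs collected into one global sign. $\mathcal A_n$ is the real algebra with basis $\Delta_n$ and product extended bilinearly (so $\mathcal A_n\cong\mathbb H^{\otimes n}$). A permutation of $\{1,2,4\}$ acts on $\Delta_n$ by permuting the digits $1,2,4$ in each position and fixing $7$; the same symbol denotes its linear extension to $\mathcal A_n$. An element $X\in\mathcal A_n$ is called symmetric with respect to the axis corresponding to $\tau$ if $\tau(X)=X$. *)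

(* Defs.v *)
From HB Require Import structures.
From mathcomp Require Import all_boot all_order all_algebra all_fingroup.
From mathcomp Require Import reals.

Set Implicit Arguments.
Unset Strict Implicit.
Unset Printing Implicit Defensive.

Import GRing.Theory.
Local Open Scope ring_scope.

(* The digits 1, 2, 4, 7, read as the quaternions i, j, k, e. *)
Inductive digit := D1 | D2 | D4 | D7.

Definition nat_of_digit (a : digit) : nat :=
  match a with D1 => 1 | D2 => 2 | D4 => 4 | D7 => 7 end.

Definition digit_of_nat (m : nat) : option digit :=
  match m with
  | 1 => Some D1 | 2 => Some D2 | 4 => Some D4 | 7 => Some D7 | _ => None
  end.

Fact nat_of_digitK : pcancel nat_of_digit digit_of_nat.
Proof. by case. Qed.

HB.instance Definition _ := Countable.copy digit (pcan_type nat_of_digitK).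

Fact digit_enumP : Finite.axiom [:: D1; D2; D4; D7].
Proof. by case. Qed.

HB.instance Definition _ := isFinite.Build digit digit_enumP.

(* [(s, c)] stands for the signed digit (-1)^s c. *)
Definition digit_mul (a b : digit) : bool * digit :=
  match a, b with
  | D7, c | c, D7 => (false, c)
  | D1, D1 | D2, D2 | D4, D4 => (true, D7)
  | D1, D2 => (false, D4) | D2, D1 => (true, D4)
  | D2, D4 => (false, D1) | D4, D2 => (true, D1)
  | D4, D1 => (false, D2) | D1, D4 => (true, D2)
  end.

Notation word n := (n.-tuple digit).

Definition word_mul n (u v : word n) : word n :=
  [tuple (digit_mul (tnth u p) (tnth v p)).2 | p < n].

Definition word_neg n (u v : word n) : bool :=
  \big[addb/false]_(p < n) (digit_mul (tnth u p) (tnth v p)).1.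

Definition word_one n : word n := [tuple D7 | p < n].

Fact digit_mul1l a : digit_mul D7 a = (false, a).
Proof. by case: a. Qed.

Fact digit_mul1r a : digit_mul a D7 = (false, a).
Proof. by case: a. Qed.

Fact digit_mulA a b c :
  (digit_mul a (digit_mul b c).2).2 = (digit_mul (digit_mul a b).2 c).2.
Proof. by case: a b c => [] [] []. Qed.

Fact digit_negA a b c :
  (digit_mul b c).1 (+) (digit_mul a (digit_mul b c).2).1 =
  (digit_mul a b).1 (+) (digit_mul (digit_mul a b).2 c).1.
Proof. by case: a b c => [] [] []. Qed.

Fact word_mul1l n (u : word n) : word_mul (word_one n) u = u.
Proof. by apply: eq_from_tnth => p; rewrite !tnth_mktuple digit_mul1l. Qed.

Fact word_mul1r n (u : word n) : word_mul u (word_one n) = u.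
Proof. by apply: eq_from_tnth => p; rewrite !tnth_mktuple digit_mul1r. Qed.

Fact word_mulA n (u v w : word n) :
  word_mul u (word_mul v w) = word_mul (word_mul u v) w.
Proof. by apply: eq_from_tnth => p; rewrite !tnth_mktuple digit_mulA. Qed.

Fact word_neg1l n (u : word n) : word_neg (word_one n) u = false.
Proof. by apply: big1 => p _; rewrite tnth_mktuple digit_mul1l. Qed.

Fact word_neg1r n (u : word n) : word_neg u (word_one n) = false.
Proof. by apply: big1 => p _; rewrite tnth_mktuple digit_mul1r. Qed.

Fact word_negA n (u v w : word n) :
  word_neg v w (+) word_neg u (word_mul v w) =
  word_neg u v (+) word_neg (word_mul u v) w.
Proof.
rewrite -!big_split; apply: eq_bigr => p _.
by rewrite !tnth_mktuple; exact: digit_negA.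
Qed.

(* An element is stored as the family of its coordinates in the basis of
   words. *)
Definition qalg (R : realType) (n : nat) := {ffun word n -> R^o}.

HB.instance Definition _ (R : realType) n :=
  GRing.Lmodule.on (qalg R n).

Section QalgTheory.
Variables (R : realType) (n : nat).
Implicit Types (X Y Z : qalg R n) (u v w : word n).

Definition basis u : qalg R n := [ffun w => (w == u)%:R].

Definition qmul X Y : qalg R n :=
  \sum_u \sum_v ((-1) ^+ word_neg u v * (X u * Y v)) *: basis (word_mul u v).

Fact basisE X : X = \sum_u X u *: basis u.
Proof.
apply/ffunP => w; rewrite sum_ffunE (bigD1 w) //= !ffunE eqxx.
rewrite big1 ?addr0 => [|u /negPf uw]; first by rewrite /GRing.scale /= mulr1.
by rewrite !ffunE eq_sym uw scaler0.
Qed.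

Fact qmulDl : left_distributive qmul +%R.
Proof.
move=> X Y Z; rewrite /qmul -big_split; apply: eq_bigr => u _.
rewrite -big_split; apply: eq_bigr => v _.
by rewrite ffunE mulrDl mulrDr scalerDl.
Qed.

Fact qmulDr : right_distributive qmul +%R.
Proof.
move=> X Y Z; rewrite /qmul -big_split; apply: eq_bigr => u _.
rewrite -big_split; apply: eq_bigr => v _.
by rewrite ffunE mulrDr mulrDr scalerDl.
Qed.

Fact qmulZl a X Y : qmul (a *: X) Y = a *: qmul X Y.
Proof.
rewrite /qmul scaler_sumr; apply: eq_bigr => u _.
rewrite scaler_sumr; apply: eq_bigr => v _.
by rewrite ffunE scalerA /GRing.scale /= -mulrA mulrCA.
Qed.

Fact qmulZr a X Y : qmul X (a *: Y) = a *: qmul X Y.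
Proof.
rewrite /qmul scaler_sumr; apply: eq_bigr => u _.
rewrite scaler_sumr; apply: eq_bigr => v _.
by rewrite ffunE scalerA /GRing.scale /= !(mulrCA a).
Qed.

Fact qmul0l : left_zero 0 qmul.
Proof. by move=> Y; apply: (addIr (qmul 0 Y)); rewrite -qmulDl !add0r. Qed.

Fact qmul0r : right_zero 0 qmul.
Proof. by move=> X; apply: (addIr (qmul X 0)); rewrite -qmulDr !add0r. Qed.

Fact qmul_suml I (r : seq I) (F : I -> qalg R n) Y :
  qmul (\sum_(i <- r) F i) Y = \sum_(i <- r) qmul (F i) Y.
Proof. exact: (big_morph (qmul^~ Y) (fun X Z => qmulDl X Z Y) (qmul0l Y)). Qed.

Fact qmul_sumr I (r : seq I) (F : I -> qalg R n) X :
  qmul X (\sum_(i <- r) F i) = \sum_(i <- r) qmul X (F i).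
Proof. exact: (big_morph (qmul X) (qmulDr X) (qmul0r X)). Qed.

Fact qmul_basis u v :
  qmul (basis u) (basis v) = (-1) ^+ word_neg u v *: basis (word_mul u v).
Proof.
rewrite /qmul (bigD1 u) //= (bigD1 v) //= !ffunE !eqxx !mulr1.
rewrite big1 ?addr0 => [|w /negPf wv]; last first.
  by rewrite !ffunE wv !mulr0 scale0r.
rewrite big1 ?addr0 // => w /negPf wu; apply: big1 => x _.
by rewrite !ffunE wu mul0r mulr0 scale0r.
Qed.

Fact qmulA : associative qmul.
Proof.
move=> X Y Z; rewrite (basisE X) qmul_suml (qmul_suml _ _ Y) (qmul_suml _ _ Z).
apply: eq_bigr => u _; rewrite !qmulZl; apply: (congr1 ( *:%R _)).
rewrite (basisE Y) (qmul_suml _ _ Z) !(qmul_sumr _ _ (basis u)) (qmul_suml _ _ Z).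
apply: eq_bigr => v _; rewrite !(qmulZl, qmulZr); apply: (congr1 ( *:%R _)).
rewrite (basisE Z) (qmul_sumr _ _ (basis v)) (qmul_sumr _ _ (basis u)).
rewrite (qmul_sumr _ _ (qmul _ _)); apply: eq_bigr => w _.
rewrite !qmulZr; apply: (congr1 ( *:%R _)).
rewrite !qmul_basis qmulZr qmulZl !qmul_basis !scalerA -!signr_addb.
by rewrite word_negA word_mulA.
Qed.

Fact qmul1l : left_id (basis (word_one n)) qmul.
Proof.
move=> X; rewrite {2}(basisE X) {1}(basisE X) qmul_sumr.
by apply: eq_bigr => u _; rewrite qmulZr qmul_basis word_neg1l word_mul1l scale1r.
Qed.

Fact qmul1r : right_id (basis (word_one n)) qmul.
Proof.
move=> X; rewrite {2}(basisE X) {1}(basisE X) qmul_suml.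
by apply: eq_bigr => u _; rewrite qmulZl qmul_basis word_neg1r word_mul1r scale1r.
Qed.

Fact qone_neq0 : basis (word_one n) != 0.
Proof.
by apply/eqP => /ffunP/(_ (word_one n))/eqP; rewrite !ffunE eqxx oner_eq0.
Qed.

HB.instance Definition _ := GRing.Zmodule_isNzRing.Build (qalg R n)
  qmulA qmul1l qmul1r qmulDl qmulDr qone_neq0.

HB.instance Definition _ := GRing.Lmodule_isLalgebra.Build R (qalg R n)
  (fun a X Y => esym (qmulZl a X Y)).

HB.instance Definition _ := GRing.Lalgebra_isAlgebra.Build R (qalg R n)
  (fun a X Y => esym (qmulZr a X Y)).

Definition word_act (s : {perm digit}) (u : word n) : word n := map_tuple s u.

Definition digit_perm_act (s : {perm digit}) (X : qalg R n) : qalg R n :=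
  \sum_u X u *: basis (word_act s u).

End QalgTheory.

Definition imaginary : {set digit} := [set D1; D2; D4].

(* The permutations of {1, 2, 4}, extended to all digits by fixing 7. *)
Definition S3 : {set {perm digit}} := Sym imaginary.

Definition is_transposition (T : finType) (s : {perm T}) : bool :=
  [exists a, exists b, (a != b) && (s == tperm a b)].

(* Main.v *)
(** Exchanging two of the imaginary units i, j, k reverses every product of two
    quaternionic digits, signs included.  Hence a transposition acts on words,
    and by linearity on the whole algebra, as an anti-automorphism:
    tau(XY) = tau(Y) tau(X), which is YX when X and Y are fixed by tau. *)

From HB Require Import structures.
Require Import Defs.
From mathcomp Require Import all_boot all_order all_algebra all_fingroup.
From mathcomp Require Import reals.

Import GRing.Theory.
Local Open Scope ring_scope.

(** A transposition is odd, so it reverses the cyclic order i, j, k that decides the sign of a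
    product of distinct units; equal units, and e with anything, commute. *)
Lemma transposition_digit_mul (tau : {perm digit}) (a b : digit) :
  tau \in S3 -> is_transposition tau ->
  digit_mul (tau a) (tau b) = ((digit_mul b a).1, tau (digit_mul b a).2).
Proof.
rewrite inE => tau_on /existsP[x /existsP[y /andP[neq_xy /eqP tauE]]].
have fix7 : tau D7 = D7 by apply: (out_perm tau_on); rewrite !inE.
(* [neq_xy] excludes [x = y] and [fix7] excludes pairs containing [D7]; six ordered pairs remain,
   each checked on all [a], [b]. *)
by case: x y neq_xy tauE fix7 => [] [] // _ ->; rewrite /tperm !permE // => _;
  case: a b => [] [].
Qed.

Lemma transposition_word_mul (n : nat) (tau : {perm digit}) (u v : word n) :
  tau \in S3 -> is_transposition tau ->
  word_mul (word_act tau u) (word_act tau v) = word_act tau (word_mul v u).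
Proof.
move=> tauS tauT; apply: eq_from_tnth => p.
by rewrite !(tnth_map, tnth_ord_tuple) transposition_digit_mul.
Qed.

Lemma transposition_word_neg (n : nat) (tau : {perm digit}) (u v : word n) :
  tau \in S3 -> is_transposition tau ->
  word_neg (word_act tau u) (word_act tau v) = word_neg v u.
Proof.
move=> tauS tauT; apply: eq_bigr => p _.
by rewrite !tnth_map transposition_digit_mul.
Qed.

Section DigitPermAct.

Variables (R : realType) (n : nat) (s : {perm digit}).

Lemma digit_perm_act_is_linear : linear (@digit_perm_act R n s).
Proof.
move=> a X Y; rewrite /digit_perm_act scaler_sumr -big_split.
by apply: eq_bigr => u _; rewrite !ffunE scalerDl scalerA.
Qed.

HB.instance Definition _ := GRing.isLinear.Build R (qalg R n) (qalg R n) _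
  (@digit_perm_act R n s) digit_perm_act_is_linear.

Lemma digit_perm_act_basis (u : word n) :
  digit_perm_act s (basis R u) = basis R (word_act s u).
Proof.
rewrite /digit_perm_act (bigD1 u) //= !ffunE eqxx scale1r big1 ?addr0 //.
by move=> v /negPf neq_vu; rewrite !ffunE neq_vu scale0r.
Qed.

End DigitPermAct.

(** Phrased with the ring product, so that it rewrites alongside the generic algebra lemmas. *)
Lemma basis_mul (R : realType) (n : nat) (u v : word n) :
  basis R u * basis R v = (-1) ^+ word_neg u v *: basis R (word_mul u v).
Proof. exact: qmul_basis. Qed.

(** Both sides are bilinear in [X] and [Y], so basis words suffice; there the sign and the word are
    compared separately. *)
Lemma transposition_act_mul (R : realType) (n : nat) (tau : {perm digit})
    (X Y : qalg R n) :
  tau \in S3 -> is_transposition tau ->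
  digit_perm_act tau (X * Y) = digit_perm_act tau Y * digit_perm_act tau X.
Proof.
move=> tauS tauT; rewrite (basisE X) mulr_suml !linear_sum mulr_sumr.
apply: eq_bigr => u _; rewrite -scalerAl !linearZ /= -scalerAr.
congr (_ *: _); rewrite (basisE Y) mulr_sumr !linear_sum mulr_suml.
apply: eq_bigr => v _; rewrite -scalerAr !linearZ /= -scalerAl.
congr (_ *: _); rewrite basis_mul linearZ /= !digit_perm_act_basis basis_mul.
by rewrite transposition_word_mul ?transposition_word_neg.
Qed.

Theorem corollary5p4 (R : realType) (n : nat) (hn : (1 <= n)%N)
    (tau : {perm digit}) (htau : tau \in S3) (htau2 : is_transposition tau)
    (X Y : qalg R n) (hX : digit_perm_act tau X = X) (hY : digit_perm_act tau Y = Y) :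
  digit_perm_act tau (X * Y) = Y * X /\
  (digit_perm_act tau (X * Y) = X * Y <-> X * Y = Y * X).
Proof.
have -> : digit_perm_act tau (X * Y) = Y * X.
  by rewrite transposition_act_mul // hX hY.
(* What remains of the equivalence is the symmetry of equality. *)
by split=> //; split=> ->.
Qed.
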